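(* Let $(A,\mathbf{B},\delta)$ be the $C$-algebra arising from a real Allen matrix $s$, with standard basis $\mathbf{B}=\{b_0,b_1,\dots,b_{r-1}\}$, character table $P=[p_{ij}]$ and structure constants $\lambda_{ijk}$. Assume $\lambda_{iij}\ge 0$ for all $i,j$. (i) If the rank $r$ of $A$ is an even integer greater than $2$, then $A$ cannot have only one degree different from $1$; that is, it is impossible that exactly one index $i$ satisfies $\delta(b_i)\neq 1$. (ii) If the rank $r$ of $A$ is greater than $3$ and $|p_{ij}|\le p_{0j}$ for all $i,j$, then it is impossible that exactly one of the degrees $\delta(b_0),\dots,\delta(b_{r-1})$ is greater than or equal to $r$ and all the remaining degrees are equal to $1$.
   Context: Fourier and Allen matrices: rows and columns of $r\times r$ matrices are indexed by $0,1,\dots,r-1$. A Fourier matrix of rank $r$ is a complex $r\times r$ matrix $S$ that is unitary and symmetric, has $S_{i0}>0$ for all $i$, and satisfies $N_{ijk}=\sum_l S_{li}S_{lj}\overline{S_{lk}}\,S_{l0}^{-1}\in\mathbb{Z}$ for all $i,j,k$. The associated Allen matrix is $s=[s_{ij}]$ with $s_{ij}=S_{ij}/S_{i0}$; it is called real if $S$ (equivalently $s$) has real entries. $C$-algebra arising from $s$: put $P=[p_{ij}]$ with $p_{ij}=s_{ij}s_{0j}$, let $b_j\in\mathbb{C}^r$ be the $j$-th column of $P$, $\mathbf{B}=\{b_0,\dots,b_{r-1}\}$, and let $A$ be the $\mathbb{C}$-span of $\mathbf{B}$ with componentwise multiplication, whose identity is $b_0$. The structure constants $\lambda_{ijk}\in\mathbb{R}$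 are given by $b_ib_j=\sum_k\lambda_{ijk}b_k$. The involution on $A$ is entrywise complex conjugation, and it maps $\mathbf{B}$ to itself, $b_j^*=b_{j^*}$. The degree map $\delta:A\to\mathbb{C}$ is the algebra homomorphism giving the $0$-th coordinate, so $\delta(b_j)=p_{0j}=s_{0j}^2>0$. The triple $(A,\mathbf{B},\delta)$ is the $C$-algebra arising from the Allen matrix $s$; $\mathbf{B}$ is its standard basis, $P$ its character table, $r$ its rank, and the numbers $\delta(b_i)$, $0\le i\le r-1$, its degrees. *)

(* Defs.v *)
From mathcomp Require Import all_boot all_order all_algebra.
From mathcomp Require Import reals complex.

Set Implicit Arguments.
Unset Strict Implicit.
Unset Printing Implicit Defensive.

Import Order.TTheory GRing.Theory Num.Theory.
Local Open Scope ring_scope.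

(* The complex field is R[i] for R : realType; in its order, 0 < z says that
   z is real and positive.  A matrix of rank r, which has an index 0, is taken
   in 'M_n.+1 with r = n.+1. *)
Section Fourier.
Variables (R : realType) (n : nat).

Definition fusion_number (S : 'M[R[i]]_n.+1) (i j k : 'I_n.+1) : R[i] :=
  \sum_l S l i * S l j * (S l k)^* * (S l 0)^-1.

Definition fourier_matrix (S : 'M[R[i]]_n.+1) : Prop :=
  [/\ S \is unitarymx,
      S^T = S,
      forall i, 0 < S i 0
    & forall i j k, exists z : int, fusion_number S i j k = z%:~R].

Definition allen_mx (S : 'M[R[i]]_n.+1) : 'M[R[i]]_n.+1 :=
  \matrix_(i, j) (S i j / S i 0).

Definition allen_matrix (s : 'M[R[i]]_n.+1) : Prop :=
  exists2 S, fourier_matrix S & s = allen_mx S.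

Definition real_matrix (s : 'M[R[i]]_n.+1) : Prop :=
  s \is a mxOver Num.real.

Definition character_table (s : 'M[R[i]]_n.+1) : 'M[R[i]]_n.+1 :=
  \matrix_(i, j) (s i j * s 0 j).

Definition standard_basis (s : 'M[R[i]]_n.+1) (j : 'I_n.+1) : 'cV[R[i]]_n.+1 :=
  col j (character_table s).

Definition cmul (u v : 'cV[R[i]]_n.+1) : 'cV[R[i]]_n.+1 := map2_mx *%R u v.

Definition degree_map (u : 'cV[R[i]]_n.+1) : R[i] := u 0 0.

Definition structure_constants (s : 'M[R[i]]_n.+1)
    (lambda : 'I_n.+1 -> 'I_n.+1 -> 'I_n.+1 -> R[i]) : Prop :=
  forall i j, cmul (standard_basis s i) (standard_basis s j) =
              \sum_k lambda i j k *: standard_basis s k.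

Lemma character_table_unit (s : 'M[R[i]]_n.+1) :
  allen_matrix s -> character_table s \in unitmx.
Proof.
case=> S [Su Ssym Spos _] ->.
pose d := \row_j (S j 0)^-1; pose e := \row_j (allen_mx S 0 j).
have -> : character_table (allen_mx S) = diag_mx d *m S *m diag_mx e.
  apply/matrixP => i j; rewrite mul_diag_mx mul_mx_diag !mxE.
  by rewrite (mulrC (S i j)).
rewrite !unitmx_mul (unitarymx_unit Su) !unitmxE !det_diag andbT.
apply/andP; split; rewrite unitfE; apply/prodf_neq0 => j _; rewrite !mxE.
  by rewrite invr_eq0 gt_eqF.
have -> : S 0 j = S j 0 by rewrite -[in LHS]Ssym mxE.
by rewrite mulf_neq0 ?invr_eq0 ?gt_eqF.
Qed.

(* The defining equation has exactly one solution. *)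
Lemma structure_constants_exists_unique (s : 'M[R[i]]_n.+1) :
  allen_matrix s ->
  exists lambda, structure_constants s lambda /\
    forall lambda', structure_constants s lambda' ->
      forall i j k, lambda' i j k = lambda i j k.
Proof.
move=> /character_table_unit Pu; set P := character_table s in Pu *.
have comb (x : 'I_n.+1 -> R[i]) :
    \sum_k x k *: standard_basis s k = P *m \col_k x k.
  apply/matrixP => i j; rewrite summxE !mxE.
  by apply: eq_bigr => k _; rewrite !mxE mulrC.
pose v i j := cmul (standard_basis s i) (standard_basis s j).
exists (fun i j k => (invmx P *m v i j) k 0); split=> [i j|la hla i j k].
  rewrite comb -/(v i j).
  have -> : \col_k (invmx P *m v i j) k 0 = invmx P *m v i j.
    by apply/colP => k; rewrite mxE.
  by rewrite mulKVmx.
by rewrite /v hla comb mulKmx // mxE.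
Qed.

End Fourier.

(* Main.v *)
Require Import Defs.
From mathcomp Require Import all_boot all_order all_algebra.
From mathcomp Require Import reals complex.
From mathcomp Require Import zify ring.

(** Let all degrees but [d = delta b_t] be 1.  If [delta b_i = 1], comparing
    degrees in [b_i b_i = sum_k lambda_iik b_k], where [lambda_ii0 = 1] and the
    other coefficients are nonnegative, gives [b_i b_i = b_0], so that
    [p_li = 1] or [-1] for every [l] and every [i <> t].  The norms of the
    rows 0 and [t] of [S] then yield [(r - 1) d <= r - 1 + d], and the
    orthogonality of a column [i], [i <> 0, t], to the column 0 shows that [d]
    is an integer; for [r > 3] this forces [d = 1]. *)

Set Implicit Arguments.
Unset Strict Implicit.
Unset Printing Implicit Defensive.

Import Order.TTheory GRing.Theory Num.Theory.
Local Open Scope ring_scope.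

Section RealAllen.
Variables (R : realType) (n : nat) (S : 'M[R[i]]_n.+1).
Hypotheses (S_fourier : fourier_matrix S) (s_real : real_matrix (allen_mx S)).

Local Notation P := (character_table (allen_mx S)).

Lemma fourier_sym i j : S i j = S j i.
Proof. by have [_ Ssym _ _] := S_fourier; rewrite -[in LHS]Ssym mxE. Qed.

Lemma fourier_gt0 i : 0 < S i 0.
Proof. by have [_ _ + _] := S_fourier. Qed.

Lemma fourier_neq0 i : S i 0 != 0.
Proof. by rewrite gt_eqF ?fourier_gt0. Qed.

Lemma fourier_real i j : S i j \is Num.real.
Proof.
have -> : S i j = allen_mx S i j * S i 0 by rewrite mxE divfK ?fourier_neq0.
by rewrite realM ?(mxOverP s_real) // gtr0_real ?fourier_gt0.
Qed.

Lemma fourier_orthogonal i k : \sum_l S i l * S k l = (i == k)%:R.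
Proof.
have [/unitarymxP/matrixP/(_ i k) + _ _ _] := S_fourier.
rewrite !mxE => <-; apply: eq_bigr => l _.
by rewrite !mxE (CrealP (fourier_real _ _)).
Qed.

Lemma character_tableE i j : P i j = S i j / S i 0 * (S j 0 / S 0 0).
Proof. by rewrite !mxE (fourier_sym 0 j). Qed.

Lemma degreeE j : degree_map (standard_basis (allen_mx S) j) = P 0 j.
Proof. by rewrite /degree_map mxE. Qed.

Lemma degree_sqr j : P 0 j = (S j 0 / S 0 0) ^+ 2.
Proof. by rewrite character_tableE fourier_sym expr2. Qed.

Lemma degree_gt0 j : 0 < P 0 j.
Proof. by rewrite degree_sqr exprn_gt0 ?divr_gt0 ?fourier_gt0. Qed.

Lemma degree0 : P 0 0 = 1.
Proof. by rewrite degree_sqr divff ?fourier_neq0 // expr1n. Qed.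

(** The degree is the square of [S j 0 / S 0 0], and positivity of column 0 excludes the root -1. *)
Lemma degree1P j : P 0 j = 1 -> S j 0 = S 0 0.
Proof.
rewrite degree_sqr => /eqP; rewrite sqrp_eq1 ?divr_ge0 ?ltW ?fourier_gt0 //.
by move=> /eqP/divr1_eq.
Qed.

Section StructureConstants.
Variable lambda : 'I_n.+1 -> 'I_n.+1 -> 'I_n.+1 -> R[i].
Hypothesis lambdaE : structure_constants (allen_mx S) lambda.

Lemma character_table_mul l i j :
  P l i * P l j = \sum_k lambda i j k * P l k.
Proof.
have /matrixP/(_ l 0) := lambdaE i j; rewrite summxE !mxE => ->.
by apply: eq_bigr => k _; rewrite !mxE.
Qed.

(** Weight coordinate [l] of [b_i b_i] by [S l 0 ^+ 2] and sum over [l]. The weights clear the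
    denominators [S l 0], so on the expanded side orthogonality of the rows of [S] leaves only
    [k = 0]. On the other side the norm 1 of row [i] leaves the degree of [b_i]. *)
Lemma structure_constant0 i : lambda i i 0 = P 0 i.
Proof.
have : \sum_l S l 0 ^+ 2 * (P l i * P l i) =
       \sum_l \sum_k lambda i i k * (S k 0 / S 0 0) * (S 0 l * S k l).
  apply: eq_bigr => l _; rewrite character_table_mul mulr_sumr.
  apply: eq_bigr => k _; rewrite character_tableE (fourier_sym k l).
  rewrite (fourier_sym 0 l); have := fourier_neq0 l; have := fourier_neq0 0.
  by move=> ? ?; field; apply/andP.
rewrite exchange_big /= [X in _ = X -> _](bigD1 0) //=.
rewrite [X in _ + X]big1 => [|k k0]; last first.
  by rewrite -mulr_sumr fourier_orthogonal eq_sym (negPf k0) mulr0.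
rewrite -mulr_sumr fourier_orthogonal eqxx divff ?fourier_neq0 // !mulr1 addr0.
move=> <-; have := fourier_orthogonal i i; rewrite eqxx => norm_i.
rewrite -[RHS]mulr1 -[X in _ = _ * X]norm_i degree_sqr mulr_sumr.
apply: eq_bigr => l _.
rewrite character_tableE (fourier_sym i l).
have := fourier_neq0 l; have := fourier_neq0 0.
by move=> ? ?; field; apply/andP.
Qed.

Lemma degree1_sqr i l : (forall k, 0 <= lambda i i k) ->
  P 0 i = 1 -> P l i ^+ 2 = 1.
Proof.
move=> lambda_ge0 di1; have := character_table_mul 0 i i.
rewrite (bigD1 0) //= structure_constant0 degree0 di1 !mulr1.
rewrite -[X in X = _ -> _]addr0 => /addrI/esym/eqP.
rewrite psumr_eq0 => [/allP lam0|k _]; last by rewrite mulr_ge0 // ltW ?degree_gt0.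
rewrite expr2 character_table_mul (bigD1 0) //= structure_constant0 di1 mul1r.
rewrite big1 => [|k k0].
  by rewrite addr0 character_tableE !divff ?fourier_neq0 // mulr1.
(* A vanishing product with a positive degree forces [lambda i i k = 0]. *)
have := lam0 k; rewrite mem_index_enum k0 mulf_eq0 (gt_eqF (degree_gt0 k)) orbF.
by move=> /(_ isT)/eqP->; rewrite mul0r.
Qed.

End StructureConstants.

Section OneDegree.
Variable t : 'I_n.+1.
Hypotheses (degree1 : forall j, j != t -> P 0 j = 1)
  (sqr1 : forall j l, j != t -> P l j ^+ 2 = 1).

(** For [j != t], [P t j] has square 1 and [S j 0 = S 0 0], so [S t j ^+ 2 = S t 0 ^+ 2 = S 0 0 ^+ 2
    * P 0 t]. Thus row [t] has norm 1 with [n] equal squares besides [S t t ^+ 2]. *)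
Lemma degree_le : n%:R * P 0 t <= n%:R + P 0 t.
Proof.
have a_gt0 := fourier_gt0 0; have a0 := fourier_neq0 0.
have card_t : \sum_(j | j != t) (1 : R[i]) = n%:R.
  by rewrite sumr_const cardC1 card_ord.
have norm0 : S 0 0 ^+ 2 * (n%:R + P 0 t) = 1.
  have := fourier_orthogonal 0 0; rewrite eqxx (bigD1 t) //= => norm1.
  rewrite -[RHS]norm1 mulrDr addrC -card_t mulr_sumr; congr (_ + _); last first.
    by rewrite degree_sqr (fourier_sym 0 t); field.
  by apply: eq_bigr => j /degree1/degree1P; rewrite fourier_sym => ->; ring.
have normt : S t t ^+ 2 + S 0 0 ^+ 2 * (n%:R * P 0 t) = 1.
  have := fourier_orthogonal t t; rewrite eqxx (bigD1 t) //= => norm1.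
  rewrite -[RHS]norm1; congr (_ + _); rewrite -card_t mulr_suml mulr_sumr.
  apply: eq_bigr => j jt; rewrite -(sqr1 t jt) character_tableE degree_sqr.
  by rewrite (degree1P (degree1 jt)); have := fourier_neq0 t => ?; field; apply/andP.
(* After scaling by [S 0 0 ^+ 2], the two sides differ by [S t t ^+ 2], which is nonnegative because
   [S] is real. *)
rewrite -(ler_pM2l (exprn_gt0 2 a_gt0)) norm0 -[leRHS]normt lerDr.
by rewrite real_exprn_even_ge0 ?fourier_real.
Qed.

(** Divided by [S 0 0 ^+ 2], the orthogonality relation says that the column [P l i], weighted by
    the degrees, sums to 0. Its entries are signs, and the only weight other than 1 is [P 0 t]. *)
Lemma degree_int i : i != 0 -> i != t -> exists z : int, P 0 t = z%:~R.
Proof.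
move=> i0 it; have a0 := fourier_neq0 0.
have : \sum_l S i l * S 0 l = 0 by rewrite fourier_orthogonal (negPf i0).
have -> : \sum_l S i l * S 0 l =
          S 0 0 ^+ 2 * (P 0 t * P t i + \sum_(l | l != t) P l i).
  rewrite (bigD1 t) //= mulrDr mulr_sumr; congr (_ + _).
    rewrite degree_sqr character_tableE (degree1P (degree1 it)) (fourier_sym i t).
    by rewrite (fourier_sym 0 t); have := fourier_neq0 t => ?; field; apply/andP.
  apply: eq_bigr => l lt; rewrite character_tableE (degree1P (degree1 it)).
  rewrite (degree1P (degree1 lt)) (fourier_sym i l) (fourier_sym 0 l).
  by rewrite (degree1P (degree1 lt)); field.
move=> /eqP; rewrite mulf_eq0 expf_eq0 (negPf a0) /= addr_eq0 => /eqP Pt.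
pose e l : int := if P l i == 1 then 1 else -1.
have Pe l : P l i = (e l)%:~R.
  have /eqP := sqr1 l it; rewrite sqrf_eq1 /e.
  by case: eqP => [->|_ /eqP] //=.
(* The relation is solved for [P 0 t] by multiplying by [P t i], a sign and hence its own
   inverse. *)
exists (- (\sum_(l | l != t) e l) * e t).
rewrite intrM mulrNz rmorph_sum /= -(eq_bigr _ (fun l _ => Pe l)) -Pt -Pe.
by rewrite -mulrA -expr2 sqr1 ?mulr1.
Qed.

Lemma exceptional_degree_eq1 : (2 < n)%N -> P 0 t = 1.
Proof.
move=> n_gt2.
have [k] : exists k, k \in ~: [set 0; t].
  apply/set0Pn; rewrite -card_gt0 cardsCs setCK card_ord.
  by rewrite cards2; case: (_ != _) => /=; lia.
rewrite !inE negb_or => /andP[k0 kt].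
have [z Pz] := degree_int k0 kt.
have := degree_le; have := degree_gt0 t; rewrite Pz ltr0z.
rewrite -[n%:R]/(n%:Z%:~R) -intrM -intrD ler_int => z_gt0 nz.
(* The bound reads [(n - 1) * (z - 1) <= 1], where [n - 1] is at least 2 and [z] at least 1. *)
by have -> : z = 1 by nia.
Qed.

End OneDegree.

End RealAllen.

(** Nothing is assumed about the degree at [t], so both parts of the theorem reduce to this: each
    contradicts the value 1 at its exceptional index. *)
Lemma allen_degree_eq1 (R : realType) (n : nat) (s : 'M[R[i]]_n.+1)
    (lambda : 'I_n.+1 -> 'I_n.+1 -> 'I_n.+1 -> R[i]) (t : 'I_n.+1) :
  allen_matrix s -> real_matrix s -> structure_constants s lambda ->
  (forall i j, 0 <= lambda i i j) -> (3 < n.+1)%N ->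
  (forall j, j <> t -> degree_map (standard_basis s j) = 1) ->
  degree_map (standard_basis s t) = 1.
Proof.
move=> [S S_fourier ->] s_real lambdaE lambda_ge0 n_gt2 deg1.
have degree1 j : j != t -> character_table (allen_mx S) 0 j = 1.
  by move=> /eqP/deg1; rewrite degreeE.
rewrite degreeE; apply: exceptional_degree_eq1 => // j l jt.
exact: (degree1_sqr S_fourier s_real lambdaE l (lambda_ge0 j) (degree1 j jt)).
Qed.

Theorem theorem19 (R : realType) (n : nat) (s : 'M[R[i]]_n.+1)
    (lambda : 'I_n.+1 -> 'I_n.+1 -> 'I_n.+1 -> R[i])
    (s_allen : allen_matrix s)
    (s_real : real_matrix s)
    (lambdaE : structure_constants s lambda)
    (lambda_ge0 : forall i j, 0 <= lambda i i j) :
  (~~ odd n.+1 -> (2 < n.+1)%N ->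
     ~ (exists! i, degree_map (standard_basis s i) <> 1))
  /\
  ((3 < n.+1)%N ->
   (forall i j, `|character_table s i j| <= character_table s 0 j) ->
     ~ (exists i,
          unique (fun k => (n.+1)%:R <= degree_map (standard_basis s k)) i /\
          (forall j, j <> i -> degree_map (standard_basis s j) = 1))).
Proof.
split=> [n_even n_gt1 [t [deg_t uniq_t]]|n_gt2 _ [t [[deg_t _] deg1]]].
  (* An even rank above 2 is at least 4. *)
  apply/deg_t/(allen_degree_eq1 s_allen s_real lambdaE lambda_ge0); first by lia.
  by move=> j jt; apply/eqP/negP => /negP/eqP/uniq_t tj; apply: jt.
(* The exceptional degree would be both 1 and at least the rank. *)
move: deg_t; rewrite (allen_degree_eq1 s_allen s_real lambdaE lambda_ge0 n_gt2 deg1).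
by rewrite lern1; lia.
Qed.
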